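(* For every $\bar{\boldsymbol\theta}=\langle(\varepsilon_n,\bar a_n)\rangle_{n\in\mathbb Z}\in\overline\Sigma^{\mathbb Z}$, the time group $\mathbf T^{\mathrm{gp}}_{\bar{\boldsymbol\theta}}$ admits a unique translation-invariant total order $<$ with the property that for all $n\in\mathbb Z$, (1) $0<Q_{[n]}<Q_{[n+1]}$; (2) if $\bar a_{n+1}=\infty$, then $kQ_{[n]}<Q_{[n+1]}$ for all $k\ge1$.
   Context: $\overline{\mathbb N}=\mathbb N\cup\{\infty\}$ with $\mathbb N=\{1,2,\dots\}$, $\overline\Sigma=\{-1,+1\}\times\overline{\mathbb N}_{\ge2}$, and $\overline\Sigma^{\mathbb Z}$ is the set of bi-infinite sequences $\langle(\varepsilon_n,\bar a_n)\rangle_{n\in\mathbb Z}$ in $\overline\Sigma$. The time group $\mathbf T^{\mathrm{gp}}_{\bar{\boldsymbol\theta}}$ is the additive abelian group generated by $\{Q_{[n]}\}_{n\in\mathbb Z}$ subject to the relations $$Q_{[n+1]}=b_{n+1}Q_{[n]}-\varepsilon_n\varepsilon_{n+1}Q_{[n-1]},\qquad b_{n+1}=\bar a_{n+1}+\frac{1+\varepsilon_{n+1}\varepsilon_{n+2}}2,$$ for all $n\in\mathbb Z$ with $\bar a_{n+1}<\infty$. *)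

(* Defs.v *)
From HB Require Import structures.
From mathcomp Require Import all_boot all_order all_algebra.
From mathcomp Require Import boolp.
From mathcomp Require Import freeg.

Set Implicit Arguments.
Unset Strict Implicit.
Unset Printing Implicit Defensive.

Import GRing.Theory Num.Theory.
Local Open Scope ring_scope.

(* The alphabet {-1, +1} * (N_{>= 2} u {oo}); the value oo is [None]. *)
Definition Sigma_bar : Type :=
  {p : int * option nat |
    ((p.1 == -1) || (p.1 == 1)) && (if p.2 is Some a then (2 <= a)%N else true)}.

Definition eps (theta : int -> Sigma_bar) (n : int) : int := (val (theta n)).1.

Definition abar (theta : int -> Sigma_bar) (n : int) : option nat :=
  (val (theta n)).2.

(* The coefficient b_n when abar theta n = Some a; the integer division is
   exact, since its numerator is 0 or 2. *)
Definition bcoef (theta : int -> Sigma_bar) (n : int) (a : nat) : int :=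
  a%:Z + ((1 + eps theta n * eps theta (n + 1)) %/ 2)%Z.

Section TimeGroup.
Variable theta : int -> Sigma_bar.

(* Free abelian group on symbols indexed by int. *)
Local Notation F := {freeg int / int}.

Definition relator (n : int) (a : nat) : F :=
  << n + 1 >> - (<< n >> *~ bcoef theta (n + 1) a
                 - << n - 1 >> *~ (eps theta n * eps theta (n + 1))).

(* The subgroup generated by the relators, as the intersection of all
   subgroups that contain them. *)
Definition relations : {pred F} := fun x =>
  `[< forall S : zmodClosed F,
        (forall n a, abar theta (n + 1) = Some a -> relator n a \in S) ->
        x \in S >].

Lemma relations_zmod_closed : zmod_closed relations.
Proof.
split=> [|x y /asboolP Sx /asboolP Sy]; apply/asboolP => S HS.
  exact: rpred0.
by apply: rpredB; [apply: Sx | apply: Sy].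
Qed.

HB.instance Definition _ :=
  GRing.isZmodClosed.Build F relations relations_zmod_closed.

Definition time_group : zmodType := {ideal_quot relations}.

Definition Q (n : int) : time_group :=
  (\pi_{ideal_quot relations} << n >>)%qT.

End TimeGroup.

Definition translation_invariant_total_order (G : zmodType) (lt : rel G) : Prop :=
  [/\ irreflexive lt,
      transitive lt,
      forall x y : G, x != y -> lt x y || lt y x
    & forall x y z : G, lt x y -> lt (x + z) (y + z)].

(* Main.v *)
Require Import Defs.
From HB Require Import structures.
From mathcomp Require Import all_boot all_order all_algebra.
From mathcomp Require Import boolp freeg zify ring.

Import Order.TTheory GRing.Theory Num.Theory.
Local Open Scope ring_scope.

(** The two conditions say which elements every such order must make positive:
the Q_n, the differences Q_(n+1) - Q_n, the differences Q_(n+1) - k Q_n at the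
infinite letters, hence also all their sums. Call an element forced positive if
it is such a sum. The forced positive elements form the positive cone of a
total order as soon as 0 is not one of them ([forced_pos_neq0]) and every
x <> 0 satisfies x or -x forced positive ([forced_pos_total]). That order is
then the only one: any other has a positive cone containing this one, and two
nested cones of total orders coincide.

0 is not forced positive because a certificate of positivity is a finite sum,
so it mentions only indices n >= m and multipliers k <= K. For given m and K
there is an integer sequence that solves the recurrence, is positive and
strictly increasing from m on, and is multiplied by more than K at the infinite
letters ([increasing_solution]): start with two values at m and m + 1 and run
the recurrence forwards, where b >= 2 keeps the sequence increasing, and
backwards, which stays integral because Q_(n-1) has coefficient -1 or 1. Such a
sequence extends to an additive map from the time group to the integers
([time_group_lift]), which is positive on the given sum.

Totality rests on a descent. An element c Q_n + d Q_(n-1) has a forced sign as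
soon as c and c + d do not have opposite signs. Otherwise |c| < |d|, and for a
finite letter the recurrence rewrites the element as
c' Q_(n-1) + d' Q_(n-2) with |d'| = |c| < |d|; hence the process stops
([Q_pair_sign]). For an infinite letter and c <> 0, the term c Q_n decides the sign, since any
combination of the lower generators is at least some -k Q_(n-1). A general
combination of Q_n, Q_(n-1), ... has its leading term eliminated by the
recurrence, or decided by an infinite letter, until at most two generators
remain ([Q_comb_sign]). *)

(** * Signs and coefficients *)

Lemma eps_sign theta n : eps theta n = -1 \/ eps theta n = 1.
Proof.
rewrite /eps; case: (theta n) => /= p /andP[/orP[/eqP|/eqP] ? _]; by [left|right].
Qed.

Lemma eps_mul_sign theta n :
  eps theta n * eps theta (n + 1) = -1 \/ eps theta n * eps theta (n + 1) = 1.
Proof. by case: (eps_sign theta n) (eps_sign theta (n + 1)) => -> [->|->]; lia. Qed.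

Lemma bcoef_ge2 theta n a : abar theta n = Some a -> (2 <= bcoef theta n a)%R.
Proof.
move=> abar_n; have a_ge2 : (2 <= a)%N.
  by move: abar_n; rewrite /abar; case: (theta n) => [[e o]] /= /andP[_ +] Ho; rewrite Ho.
by rewrite /bcoef; case: (eps_mul_sign theta n) => ->; lia.
Qed.

(** * Additive maps out of the time group *)

Lemma freeg_lift (f : int -> int) :
  exists G : {additive {freeg int / int} -> int}, forall n, G << n >> = f n.
Proof.
pose g : {freeg int / int} -> int := fglift (f : int -> int^o).
have gB : zmod_morphism g by exact: (@lift_is_additive int int int^o f).
pose gM := GRing.isZmodMorphism.Build _ _ g gB.
pose G : {additive {freeg int / int} -> int} := HB.pack g gM.
by exists G => n; rewrite /= /g liftU scale1r.
Qed.

Section TimeGroupOrder.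
Variable theta : int -> Sigma_bar.
Local Notation T := (time_group theta).
Local Notation q := (Q theta).

Lemma Q_recurrence n a : abar theta (n + 1) = Some a ->
  q (n + 1) = q n *~ bcoef theta (n + 1) a
              - q (n - 1) *~ (eps theta n * eps theta (n + 1)).
Proof.
move=> abar_n; rewrite /Q -!raddfMz -raddfB /=.
apply/eqP; rewrite -Quotient.idealrBE.
by apply/asboolP => S relS; apply: relS.
Qed.

Definition solves_recurrence (f : int -> int) :=
  forall n a, abar theta (n + 1) = Some a ->
    f (n + 1) = bcoef theta (n + 1) a * f n
                - eps theta n * eps theta (n + 1) * f (n - 1).

(** The universal property of the presentation. The kernel of the map induced
on the free group is one of the subgroups intersected in [relations], so the
value on a class does not depend on the representative. *)
Lemma time_group_lift (f : int -> int) : solves_recurrence f ->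
  exists phi : {additive T -> int}, forall n, phi (q n) = f n.
Proof.
move=> f_rec.
have [G gU] := freeg_lift f.
pose kerG : {pred {freeg int / int}} := fun D => G D == 0.
have kerG_closed : zmod_closed kerG.
  split=> [|x y]; rewrite !unfold_in ?raddf0 // raddfB => /eqP -> /eqP ->.
  by rewrite subrr.
pose kerM := GRing.isZmodClosed.Build _ kerG kerG_closed.
pose K : zmodClosed {freeg int / int} := HB.pack kerG kerM.
have ker_rel D : D \in relations theta -> G D = 0.
  move=> /asboolP/(_ K) relD; apply/eqP; apply: relD => n a abar_n.
  rewrite unfold_in; change (G (relator theta n a) == 0); rewrite /relator.
  rewrite !(raddfB G) !(raddfMz G) !gU (f_rec n a abar_n).
  by apply/eqP; rewrite !mulrzz; ring.
have GE x y : \pi_(T)%qT x = \pi_(T)%qT y -> G x = G y.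
  move=> /eqP; rewrite -Quotient.idealrBE => /ker_rel.
  by rewrite raddfB => /eqP; rewrite subr_eq0 => /eqP.
pose phi (x : T) := G (repr x).
have phiB : zmod_morphism phi.
  move=> x y; rewrite /phi -raddfB; apply: GE.
  by rewrite reprK raddfB /= !reprK.
pose phiM := GRing.isZmodMorphism.Build _ _ phi phiB.
pose Phi : {additive T -> int} := HB.pack phi phiM.
exists Phi => n /=.
by rewrite -gU; apply: GE; rewrite reprK.
Qed.


(** * Integer solutions of the recurrence *)

(** A recursion of order two that can be run in both directions is solved on
all of [int] by its values at two consecutive places. *)
Lemma two_sided_recursion (X : Type) (fwd bwd : int -> X -> X -> X)
    (x0 x1 : X) (m : int) :
  exists f : int -> X,
    [/\ f m = x0, f (m + 1) = x1,
        forall n, m < n -> f (n + 1) = fwd n (f (n - 1)) (f n)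
      & forall n, n <= m -> f (n - 1) = bwd n (f n) (f (n + 1))].
Proof.
pose U i := iteri i (fun j p => (p.2, fwd (m + j%:Z + 1) p.1 p.2)) (x0, x1).
pose V i := iteri i (fun j p => (bwd (m - j%:Z) p.1 p.2, p.1)) (x0, x1).
pose f n := match n - m with Posz i => (U i).1 | Negz i => (V i.+1).1 end.
have fU i : f (m + i%:Z) = (U i).1.
  by rewrite /f; have -> : m + i%:Z - m = i%:Z by lia.
have fU1 i : f (m + i%:Z + 1) = (U i).2.
  by have -> : m + i%:Z + 1 = m + i.+1%:Z by lia; rewrite fU.
have fV i : f (m - i%:Z) = (V i).1.
  case: i => [|i]; first by rewrite subr0 -[m in f m]addr0 (fU 0%N).
  by rewrite /f; have -> : m - i.+1%:Z - m = Negz i by lia.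
have fV1 i : f (m - i%:Z + 1) = (V i).2.
  case: i => [|i]; first by rewrite subr0 -[m in f (m + 1)]addr0 (fU1 0%N).
  by have -> : m - i.+1%:Z + 1 = m - i%:Z by lia; rewrite fV.
exists f; split.
- by rewrite -[m in f m]addr0 (fU 0%N).
- by rewrite -[m in f (m + 1)]addr0 (fU1 0%N).
- move=> n m_lt_n; have [i ->] : exists i : nat, n = m + i%:Z + 1.
    by exists (absz (n - m - 1)%R); lia.
  have -> : f (m + i%:Z + 1 + 1) = (U i.+1).2.
    by rewrite -fU1; congr f; lia.
  by rewrite addrK fU fU1.
- move=> n n_le_m; have [i ->] : exists i : nat, n = m - i%:Z.
    by exists (absz (m - n)%R); lia.
  have -> : m - i%:Z - 1 = m - i.+1%:Z by lia.
  by rewrite fV1 !fV.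
Qed.

(** Truncation of the two order conditions to what one finite certificate of
positivity can use. *)
Definition increasing_from (m : int) (K : nat) (f : int -> int) :=
  forall n, m <= n ->
    [/\ 0 < f n, f n < f (n + 1)
      & abar theta (n + 1) = None ->
        forall k : nat, (k <= K)%N -> f n *+ k < f (n + 1)].

Lemma increasing_solution (m : int) (K : nat) :
  exists f : int -> int, solves_recurrence f /\ increasing_from m K f.
Proof.
pose s n := eps theta n * eps theta (n + 1).
(* The factor K + 2, rather than K + 1, keeps the sequence strictly increasing
   when K = 0. *)
pose fwd n (x y : int) :=
  if abar theta (n + 1) is Some a then bcoef theta (n + 1) a * y - s n * x
  else K.+2%:Z * y.
pose bwd n (y z : int) :=
  if abar theta (n + 1) is Some a then s n * (bcoef theta (n + 1) a * y - z)
  else 0.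
have [f [fm fm1 f_fwd f_bwd]] := two_sided_recursion int fwd bwd 1 K.+2%:Z m.
have f_mono i : 0 < f (m + i%:Z) /\ f (m + i%:Z) < f (m + i%:Z + 1).
  elim: i => [|i [IH0 IH1]]; first by rewrite addr0 fm fm1; lia.
  have -> : m + i.+1%:Z = m + i%:Z + 1 by lia.
  split; first lia.
  rewrite (f_fwd (m + i%:Z + 1)) ?addrK; last by lia.
  rewrite /fwd; case abar_n: (abar _ _) => [a|]; last by nia.
  have := bcoef_ge2 _ _ _ abar_n.
  by rewrite /s; case: (eps_mul_sign theta (m + i%:Z + 1)) => ->; nia.
exists f; split=> [n a abar_n | n m_le_n].
  have [m_lt_n | n_le_m] := boolP (m < n); first by rewrite f_fwd // /fwd abar_n.
  (* The backward step inverts the recurrence because the sign squares to 1. *)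
  rewrite (f_bwd n) /bwd ?abar_n /s; last by lia.
  by case: (eps_mul_sign theta n) => ->; ring.
have [i n_eq] : exists i : nat, n = m + i%:Z by exists (absz (n - m)%R); lia.
have [f_pos f_lt] := f_mono i.
rewrite -n_eq in f_pos f_lt; split=> // abar_n k k_le_K.
have [m_lt_n | n_le_m] := boolP (m < n).
  rewrite f_fwd // /fwd abar_n -mulr_natl; nia.
have -> : n = m by lia.
by rewrite fm fm1; lia.
Qed.

(** * The forced positive cone *)

(** The cone generated by the elements that the two order conditions make
positive; each of these orders makes all of it positive. *)
Inductive forced_pos : T -> Prop :=
| Forced_gen n : forced_pos (q n)
| Forced_step n : forced_pos (q (n + 1) - q n)
| Forced_jump n (k : nat) : abar theta (n + 1) = None -> (1 <= k)%N ->
    forced_pos (q (n + 1) - q n *+ k)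
| Forced_add x y : forced_pos x -> forced_pos y -> forced_pos (x + y).

(** A forced positive element is a finite sum of generators, so finitely many
constraints on an additive map suffice to make its value positive. *)
Lemma forced_pos_lift x : forced_pos x ->
  exists (m : int) (K : nat), forall phi : {additive T -> int},
    increasing_from m K (phi \o q) -> 0 < phi x.
Proof.
elim=> [n|n|n k abar_n k_gt0|{}x y _ [m1 [K1 IH1]] _ [m2 [K2 IH2]]].
- by exists n, 0%N => phi /(_ n (lexx n)) [].
- exists n, 0%N => phi /(_ n (lexx n)) [_ ? _].
  by rewrite raddfB subr_gt0.
- exists n, k => phi /(_ n (lexx n)) [_ _ /(_ abar_n k (leqnn k))].
  by rewrite raddfB raddfMn subr_gt0.
- exists (Num.min m1 m2), (maxn K1 K2) => phi phi_inc; rewrite raddfD.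
  apply: addr_gt0.
    apply: IH1 => n n_ge; have /phi_inc[? ? H] : Num.min m1 m2 <= n by lia.
    by split=> // abar_n k k_le; apply: H => //; lia.
  apply: IH2 => n n_ge; have /phi_inc[? ? H] : Num.min m1 m2 <= n by lia.
  by split=> // abar_n k k_le; apply: H => //; lia.
Qed.

Lemma forced_pos_neq0 x : forced_pos x -> x <> 0.
Proof.
move=> /forced_pos_lift [m [K x_pos]] x0.
have [f [f_rec f_inc]] := increasing_solution m K.
have [phi phiE] := time_group_lift f f_rec.
suff : 0 < phi x by rewrite x0 raddf0.
by apply: x_pos => n /f_inc; rewrite /= !phiE.
Qed.

Definition forced_nonneg (x : T) := x = 0 \/ forced_pos x.

Lemma forced_nonneg_add x y :
  forced_nonneg x -> forced_nonneg y -> forced_nonneg (x + y).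
Proof.
move=> [->|x_pos] [->|y_pos]; rewrite ?add0r ?addr0; [by left|by right|by right|].
by right; apply: Forced_add.
Qed.

Lemma forced_nonneg_mulrz x (c : int) :
  forced_nonneg x -> 0 <= c -> forced_nonneg (x *~ c).
Proof.
case: c => // k x_ge0 _; rewrite -pmulrn.
elim: k => [|k IH]; first by left.
by rewrite mulrS; apply: forced_nonneg_add.
Qed.

Lemma forced_nonneg_gen n : forced_nonneg (q n).
Proof. by right; apply: Forced_gen. Qed.

Lemma forced_nonneg_step n : forced_nonneg (q n - q (n - 1)).
Proof. by right; rewrite -[n in q n](subrK 1); apply: Forced_step. Qed.

Lemma forced_nonneg_jump n (k : int) :
  abar theta n = None -> 0 <= k -> forced_nonneg (q n - q (n - 1) *~ k).
Proof.
case: k => // -[|k] abar_n _; first by rewrite mulr0z subr0; apply: forced_nonneg_gen.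
by right; rewrite -[n in q n](subrK 1); apply: Forced_jump; rewrite ?subrK.
Qed.

Lemma Q_pair_nonneg n (c d : int) :
  0 <= c -> 0 <= c + d -> forced_nonneg (q n *~ c + q (n - 1) *~ d).
Proof.
move=> c_ge0 cd_ge0.
have -> : q n *~ c + q (n - 1) *~ d
        = (q n - q (n - 1)) *~ c + q (n - 1) *~ (c + d).
  by rewrite mulrzBl mulrzDr addrA subrK.
apply: forced_nonneg_add; apply: forced_nonneg_mulrz => //.
  exact: forced_nonneg_step.
exact: forced_nonneg_gen.
Qed.

(** At an infinite letter Q_n exceeds every k Q_(n-1), so a single copy of Q_n
compensates any lower bound -k Q_(n-1) on the remaining terms. *)
Lemma Q_jump_nonneg n (c k : int) y : abar theta n = None -> 0 < c -> 0 <= k ->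
  forced_nonneg (q (n - 1) *~ k + y) -> forced_nonneg (q n *~ c + y).
Proof.
move=> abar_n c_gt0 k_ge0 y_ge.
have -> : q n *~ c + y
        = q n *~ (c - 1) + (q n - q (n - 1) *~ k) + (q (n - 1) *~ k + y).
  by rewrite mulrzBr mulr1z !addrA !subrK.
apply: forced_nonneg_add => //; apply: forced_nonneg_add.
  by apply: forced_nonneg_mulrz; [exact: forced_nonneg_gen | lia].
exact: forced_nonneg_jump.
Qed.

(** The new coefficient of Q_(n-2) is, up to sign, the old coefficient c: this
is the quantity that decreases in the descent. *)
Lemma Q_descent n a (c d : int) y : abar theta n = Some a ->
  q n *~ c + (q (n - 1) *~ d + y)
  = q (n - 1) *~ (bcoef theta n a * c + d)
    + (q (n - 2) *~ (- (eps theta (n - 1) * eps theta n) * c) + y).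
Proof.
move=> abar_n; have := Q_recurrence (n - 1) a; rewrite !subrK => /(_ abar_n) ->.
have -> : n - 1 - 1 = n - 2 by lia.
by rewrite mulrzBl (mulrzDr _ (_ * _)) -!mulrzA mulNr mulrNz -!addrA; congr (_ + _); rewrite addrCA.
Qed.

(** * Every element has a forced sign *)

Definition forced_sign x := forced_nonneg x \/ forced_nonneg (- x).

(** Induction on |d|. When c and c + d have opposite signs, |c| < |d|, and the
recurrence moves to the pair below with c, up to sign, as its second
coefficient. *)
Lemma Q_pair_sign n (c d : int) : forced_sign (q n *~ c + q (n - 1) *~ d).
Proof.
have [e] := ubnP (absz d); elim: e n c d => // e IHe n c d d_le_e.
have opp_pair : - (q n *~ c + q (n - 1) *~ d)
              = q n *~ (- c) + q (n - 1) *~ (- d).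
  by rewrite opprD !mulrNz.
have [[c_ge0 cd_ge0]|[[c_le0 cd_le0]|c_lt_d]] :
    0 <= c /\ 0 <= c + d \/ c <= 0 /\ c + d <= 0 \/ c != 0 /\ `|c| < `|d| by lia.
- by left; apply: Q_pair_nonneg.
- by right; rewrite opp_pair; apply: Q_pair_nonneg; lia.
case abar_n: (abar theta n) => [a|].
  rewrite -[_ *~ d]addr0 (Q_descent n a) // addr0.
  have -> : n - 2 = n - 1 - 1 by lia.
  apply: IHe; have := eps_mul_sign theta (n - 1); rewrite subrK.
  by case=> ->; lia.
have [c_gt0|c_le0] := boolP (0 < c); [left | right; rewrite opp_pair].
  apply: (Q_jump_nonneg _ _ `|d|) => //; rewrite -mulrzDr.
  by apply: forced_nonneg_mulrz; [exact: forced_nonneg_gen | lia].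
apply: (Q_jump_nonneg _ _ `|d|) => //; first by lia.
rewrite -mulrzDr.
by apply: forced_nonneg_mulrz; [exact: forced_nonneg_gen | lia].
Qed.

Fixpoint Q_comb (n : int) (s : seq int) : T :=
  if s is c :: s' then q n *~ c + Q_comb (n - 1) s' else 0.

Lemma Q_combN n s : Q_comb n (map -%R s) = - Q_comb n s.
Proof.
by elim: s n => [|c s IH] n /=; rewrite ?oppr0 // IH mulrNz opprD.
Qed.

(** Every combination of Q_n, Q_(n-1), ... is at least -k Q_n for some k,
because the generators increase. Applied to the opposite combination this also
gives upper bounds. *)
Lemma Q_comb_bounded n s :
  exists2 k : int, 0 <= k & forced_nonneg (q n *~ k + Q_comb n s).
Proof.
elim: s n => [|c s IH] n /=.
  by exists 0 => //; rewrite mulr0z addr0; left.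
have [k k_ge0 IHk] := IH (n - 1).
exists (k + `|c|); first by lia.
have -> : q n *~ (k + `|c|) + (q n *~ c + Q_comb (n - 1) s)
        = (q n - q (n - 1)) *~ k + q n *~ (`|c| + c)
          + (q (n - 1) *~ k + Q_comb (n - 1) s).
  rewrite mulrzBl !mulrzDr !addrA; congr (_ + _).
  by rewrite -[LHS](subrK (q (n - 1) *~ k)) [_ - _]addrAC [_ - _]addrAC.
apply: forced_nonneg_add => //; apply: forced_nonneg_add.
  by apply: forced_nonneg_mulrz => //; exact: forced_nonneg_step.
by apply: forced_nonneg_mulrz; [exact: forced_nonneg_gen | lia].
Qed.

(** Induction on the number of generators. The recurrence removes Q_n at the
cost of Q_(n-2), which saves a generator only from three generators on; fewer
are left to [Q_pair_sign]. *)
Lemma Q_comb_sign n s : forced_sign (Q_comb n s).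
Proof.
have [e] := ubnP (size s); elim: e n s => // e IHe n [|c s] /= size_s.
  by left; left.
case abar_n: (abar theta n) => [a|].
  case: s size_s => [|d [|d' s]] /= size_s.
  - by rewrite -[0](mulr0z (q (n - 1))); apply: Q_pair_sign.
  - by rewrite addr0; apply: Q_pair_sign.
  rewrite (Q_descent n a) // addrA -addrA.
  have -> : n - 1 - 1 = n - 2 by lia.
  rewrite (addrA (q (n - 2) *~ _)) -mulrzDr.
  have -> : n - 2 = n - 1 - 1 by lia.
  exact: (IHe (n - 1) (_ :: _ :: _)).
have [c_gt0|c_lt0|<-] := ltgtP 0 c; last first.
- by rewrite mulr0z add0r; apply: IHe; lia.
- right; rewrite opprD -mulrNz -Q_combN.
  have [k k_ge0 bound] := Q_comb_bounded (n - 1) (map -%R s).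
  by apply: (Q_jump_nonneg _ _ k) => //; lia.
- left; have [k k_ge0 bound] := Q_comb_bounded (n - 1) s.
  exact: (Q_jump_nonneg _ _ k).
Qed.

(** The two lemmas below allow arbitrary generators to be collected into one
combination: raise its top index, then add the new generator inside. *)
Lemma Q_comb_raise n s (j : nat) : Q_comb (n + j%:Z) (nseq j 0 ++ s) = Q_comb n s.
Proof.
elim: j => [|j IH]; rewrite ?addr0 //= mulr0z add0r -[RHS]IH.
by congr Q_comb; lia.
Qed.

Lemma Q_comb_add n s (j : nat) (c : int) :
  exists s', Q_comb n s' = q (n - j%:Z) *~ c + Q_comb n s.
Proof.
elim: j n s => [|j IH] n [|d s].
- by exists [:: c]; rewrite subr0.
- by exists (c + d :: s); rewrite /= subr0 mulrzDr addrA.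
- have [s' E] := IH (n - 1) [::]; exists (0 :: s') => /=.
  by rewrite E mulr0z add0r /=; congr (q _ *~ c + 0); lia.
- have [s' E] := IH (n - 1) s; exists (d :: s') => /=.
  by rewrite E addrCA; congr (q _ *~ c + _); lia.
Qed.

Lemma time_group_comb x : exists n s, x = Q_comb n s.
Proof.
rewrite -[x]reprK -(freeg_sumE (repr x)) raddf_sum /=.
elim: (dom (repr x)) => [|z D [n [s E]]].
  by exists 0, [::]; rewrite big_nil.
rewrite big_cons E.
(* Raising the top index by |n - z| makes it at least z. *)
pose j := absz (n - z)%R.
have [s' E'] := Q_comb_add (n + j%:Z) (nseq j 0 ++ s)
                  (absz (n + j%:Z - z)%R) (coeff z (repr x)).
exists (n + j%:Z), s'; rewrite E' Q_comb_raise; congr (_ + _).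
have -> : n + j - (absz (n + j%:Z - z)%R)%:Z = z by lia.
by rewrite /Q -raddfMz freegU_mulz (intz (coeff z _)).
Qed.

Lemma forced_pos_total x : x <> 0 -> forced_pos x \/ forced_pos (- x).
Proof.
move=> x_neq0; have [n [s xE]] := time_group_comb x.
have [] := Q_comb_sign n s; rewrite -xE => -[x0|]; [by []|by left| |by right].
by rewrite -[x]opprK x0 oppr0 in x_neq0.
Qed.

End TimeGroupOrder.

(** * The unique order *)

Theorem proposition5p3 (theta : int -> Sigma_bar) :
  exists! lt : rel (time_group theta),
    translation_invariant_total_order lt /\
    forall n : int,
      (lt 0 (Q theta n) /\ lt (Q theta n) (Q theta (n + 1))) /\
      (abar theta (n + 1) = None ->
       forall k : nat, (1 <= k)%N -> lt (Q theta n *+ k) (Q theta (n + 1))).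
Proof.
exists (fun x y => `[< forced_pos theta (y - x) >]); split.
  split; first split.
  - move=> x; apply/asboolP; rewrite subrr => /forced_pos_neq0; exact.
  - move=> y x z /asboolP xy /asboolP yz; apply/asboolP.
    by rewrite -(subrK y z) -addrA; apply: Forced_add.
  - move=> x y x_neq_y; apply/orP.
    have [||H] := forced_pos_total theta (y - x).
    + by move/eqP; rewrite subr_eq0 eq_sym (negPf x_neq_y).
    + by left; apply/asboolP.
    + by right; apply/asboolP; rewrite -opprB.
  - move=> x y z /asboolP xy; apply/asboolP.
    by rewrite opprD addrACA subrr addr0.
  - move=> n; split; first split; first by apply/asboolP; rewrite subr0; apply: Forced_gen.
      by apply/asboolP; apply: Forced_step.
    by move=> abar_n k k_gt0; apply/asboolP; apply: Forced_jump.
move=> lt [[lt_irr lt_trans lt_total lt_add] lt_Q].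
have lt_sub x y : lt 0 (y - x) -> lt x y.
  by move=> /(lt_add _ _ x); rewrite add0r subrK.
have sub_lt x y : lt x y -> lt 0 (y - x).
  by move=> /(lt_add _ _ (- x)); rewrite subrr.
have lt_forced x : forced_pos theta x -> lt 0 x.
  elim=> [n|n|n k abar_n k_gt0|{}x y _ x_pos _ y_pos].
  - by case: (lt_Q n) => -[].
  - by apply: sub_lt; case: (lt_Q n) => -[].
  - by apply: sub_lt; case: (lt_Q n) => _; apply.
  - by apply: lt_trans y_pos _; have := lt_add _ _ y x_pos; rewrite add0r.
(* Nested positive cones of two total orders coincide. *)
apply/funext => x; apply/funext => y; apply/asboolP/idP => [/lt_forced/lt_sub //|lt_xy].
have [|//|] := forced_pos_total theta (y - x).
  by move/eqP; rewrite subr_eq0 => /eqP yx; rewrite yx lt_irr in lt_xy.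
rewrite opprB => /lt_forced/lt_sub lt_yx.
by have := lt_trans _ _ _ lt_xy lt_yx; rewrite lt_irr.
Qed.
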